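(* Let $\hat Z^{*}\ne\emptyset$ and $\hat z^{*}\in\hat Z^{*}$. Suppose that $g$ is twice differentiable and that problem $(\mathrm{P})$ is strongly regular at $\hat z^{*}$. Suppose further that there is a constant $0\le\kappa<\frac1{2\gamma}$ such that $\|F'(\hat z^{*})-\tilde F'_j\|\le\kappa$ (for all $j$, for iterates $z^j$ in a ball $\mathcal{B}(\hat z^{*},\hat r_z)$). Then there exists a neighborhood $\mathcal{B}(\hat z^{*},r_z)$ of $\hat z^{*}$ such that, in this neighborhood, the convex subproblem $\mathrm{P}(z^j,A_j,H_j)$ has a unique KKT point $z^{j+1}$ for any $z^j\in\mathcal{B}(\hat z^{*},r_z)$. Moreover, if, in addition, there is a constant $0\le\omega<+\infty$ such that $\|F'(z)-F'(\hat z^{*})\|\le\omega\|z-\hat z^{*}\|$ for all $z\in\mathcal{B}(\hat z^{*},r_z)$, then the sequence $\{z^j\}_{j\ge0}$ generated by the full-step adjoint-based SCP algorithm (FASCP) starting from $z^0\in\mathcal{B}(\hat z^{*},r_z)$ satisfies $$\|z^{j+1}-\hat z^{*}\|\le(\hat\alpha+\hat c_1\|z^j-\hat z^{*}\|)\|z^j-\hat z^{*}\|,\quad\forall j\ge0,$$ where $0\le\hat\alpha<1$ and $0\le\hat c_1<+\infty$ are constants. Consequently, this sequence converges linearly to $\hat z^{*}$, the unique KKT point of $(\mathrm{P})$ in $\mathcal{B}(\hat z^{*},r_z)$.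
   Context: Notation: $\|\cdot\|$ is the Euclidean norm (and the induced norm for matrices); $\mathcal{B}(x,r)$ is the open ball of radius $r$ centered at $x$; $\mathcal{S}^n_+$ is the set of real symmetric positive semidefinite $n\times n$ matrices; $g'$ is the Jacobian of $g$. Problem. Let $c\in\mathbb{R}^n$, $g:\mathbb{R}^n\to\mathbb{R}^m$ and let $\Omega\subseteq\mathbb{R}^n$ be nonempty, closed and convex. $(\mathrm{P})$ is: $\min_{x\in\mathbb{R}^n}c^Tx$ subject to $g(x)=0$, $x\in\Omega$. Let $\mathcal{N}_\Omega(x)=\{u:u^T(x-v)\ge0\ \forall v\in\Omega\}$ if $x\in\Omega$ and $\emptyset$ otherwise be the normal cone. Put $K:=\Omega\times\mathbb{R}^m$ with normal cone $\mathcal{N}_K$, $z=(x,y)\in\mathbb{R}^n\times\mathbb{R}^m$ and $$F(z):=\begin{pmatrix}c+g'(x)^Ty\\ g(x)\end{pmatrix}.$$ A KKT point of $(\mathrm{P})$ is a $z$ with $0\in F(z)+\mathcal{N}_K(z)$; $\hat Z^{*}$ is the set of KKT points. Strong regularity. $(\mathrm{P})$ is strongly regular at $\hat z^{*}\in\hat Z^{*}$ if there are balls $\mathcal{B}(0,\bar r_\delta)$ and $\mathcal{B}(\hat z^{*},\bar r_z)$ such that $\delta\mapsto\mathcal{B}(\hat z^{*},\bar r_z)\cap\{z:\delta\in F(\hat z^{*})+F'(\hat z^{*})(z-\hat z^{*})+\mathcal{N}_K(z)\}$ is single-valued and Lipschitz continuous on $\mathcal{B}(0,\bar r_\delta)$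 with Lipschitz constant $0<\gamma<+\infty$. Subproblem. Given $z^j=(x^j,y^j)\in\Omega\times\mathbb{R}^m$, $A_j\in\mathbb{R}^{m\times n}$, $H_j\in\mathcal{S}^n_+$, let $m^j:=(g'(x^j)-A_j)^Ty^j$. $\mathrm{P}(z^j,A_j,H_j)$ is the convex problem: $\min_x\{c^Tx+(m^j)^T(x-x^j)+\frac12(x-x^j)^TH_j(x-x^j)\}$ subject to $g(x^j)+A_j(x-x^j)=0$, $x\in\Omega$. With $$\tilde F'_j:=\begin{bmatrix}H_j&A_j^T\\ A_j&0\end{bmatrix},$$ its KKT points are the $z$ with $0\in F(z^j)+\tilde F'_j(z-z^j)+\mathcal{N}_K(z)$. The Slater condition $\mathrm{ri}(\Omega)\cap\{x:g(x^j)+A_j(x-x^j)=0\}\neq\emptyset$ is assumed, so KKT points are exactly the pairs (solution, multiplier). Algorithm FASCP. Start from $z^0=(x^0,y^0)\in\Omega\times\mathbb{R}^m$, a matrix $A_0$ approximating $g'(x^0)$ and $H_0\in\mathcal{S}^n_+$. At iteration $j=0,1,\dots$ let $z^{j+1}=(x^{j+1},y^{j+1})$ be the solution and corresponding multiplier of $\mathrm{P}(z^j,A_j,H_j)$ (full step), and choose new $A_{j+1}$ and $H_{j+1}\in\mathcal{S}^n_+$. (The stopping test is ignored, so that an infinite sequence is generated.) *)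

(* Defs.v *)
(* Vectors are columns, and z = (x, y) in R^n x R^m is the column
   col_mx x y : 'cV_(n + m), with x = usubmx z and y = dsubmx z.
   The library norm on matrices is the max-norm, so the Euclidean norm, its
   balls and the induced matrix norm are defined here; topological notions
   (closed, differentiable, convergence) are the library's, since in finite
   dimension they do not depend on the norm. *)
From HB Require Import structures.
From mathcomp Require Import all_boot all_order all_algebra.
From mathcomp Require Import all_classical all_reals all_analysis.
Import Order.TTheory GRing.Theory Num.Theory.
Import numFieldNormedType.Exports.

Set Implicit Arguments.
Unset Strict Implicit.
Unset Printing Implicit Defensive.

Local Open Scope classical_set_scope.
Local Open Scope ring_scope.

Definition vdot (R : realType) (n : nat) (u v : 'cV[R]_n) : R :=
  (u^T *m v) 0 0.

Definition enorm (R : realType) (n : nat) (x : 'cV[R]_n) : R :=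
  Num.sqrt (vdot x x).

Definition eball (R : realType) (n : nat) (x : 'cV[R]_n) (r : R) :
    set 'cV[R]_n :=
  [set z | enorm (z - x) < r].

Definition opnorm (R : realType) (m n : nat) (A : 'M[R]_(m, n)) : R :=
  sup [set enorm (A *m x) | x in [set x : 'cV[R]_n | enorm x <= 1]].

(* Jacobian matrix acting on column vectors: column j is 'd f x e_j.  (The
   library's jacobian is the transposed matrix, for maps on row vectors.) *)
Definition jac (R : realType) (n m : nat) (f : 'cV[R]_n -> 'cV[R]_m)
    (x : 'cV[R]_n) : 'M[R]_(m, n) :=
  \matrix_(i, j) ('d f x (delta_mx j 0)) i 0.

Definition twice_differentiable (R : realType) (n m : nat)
    (f : 'cV[R]_n -> 'cV[R]_m) : Prop :=
  (forall x, differentiable f x) /\ (forall x, differentiable (jac f) x).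

Definition symmetric_psd (R : realType) (n : nat) (H : 'M[R]_n) : Prop :=
  H^T = H /\ forall x : 'cV[R]_n, 0 <= vdot x (H *m x).

Definition affine_hull (R : realType) (n : nat) (S : set 'cV[R]_n) :
    set 'cV[R]_n :=
  [set x | exists (k : nat) (v : 'I_k -> 'cV[R]_n) (l : 'I_k -> R),
     [/\ forall i, S (v i), \sum_i l i = 1 & x = \sum_i l i *: v i]].

Definition relint (R : realType) (n : nat) (S : set 'cV[R]_n) :
    set 'cV[R]_n :=
  [set x | S x /\
     exists2 e : R, 0 < e & eball x e `&` affine_hull S `<=` S].

Definition normal_cone (R : realType) (n : nat) (S : set 'cV[R]_n)
    (x : 'cV[R]_n) : set 'cV[R]_n :=
  [set u | S x /\ forall v, S v -> 0 <= vdot u (x - v)].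

(* K = Omega x R^m *)
Definition Kset (R : realType) (n m : nat) (Omega : set 'cV[R]_n) :
    set 'cV[R]_(n + m) :=
  [set z | Omega (usubmx z)].

Definition KKT_map (R : realType) (n m : nat) (c : 'cV[R]_n)
    (g : 'cV[R]_n -> 'cV[R]_m) (z : 'cV[R]_(n + m)) : 'cV[R]_(n + m) :=
  col_mx (c + (jac g (usubmx z))^T *m dsubmx z) (g (usubmx z)).

Definition KKT_points (R : realType) (n m : nat) (c : 'cV[R]_n)
    (g : 'cV[R]_n -> 'cV[R]_m) (Omega : set 'cV[R]_n) :
    set 'cV[R]_(n + m) :=
  [set z | [set KKT_map c g z + u | u in normal_cone (Kset Omega) z] 0].

(* The z with delta \in F(zs) + F'(zs) (z - zs) + N_K(z). *)
Definition linearized_solutions (R : realType) (n m : nat) (c : 'cV[R]_n)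
    (g : 'cV[R]_n -> 'cV[R]_m) (Omega : set 'cV[R]_n)
    (zs delta : 'cV[R]_(n + m)) : set 'cV[R]_(n + m) :=
  [set z | [set KKT_map c g zs + jac (KKT_map c g) zs *m (z - zs) + u
             | u in normal_cone (Kset Omega) z] delta].

Definition strongly_regular (R : realType) (n m : nat) (c : 'cV[R]_n)
    (g : 'cV[R]_n -> 'cV[R]_m) (Omega : set 'cV[R]_n)
    (zs : 'cV[R]_(n + m)) (gamma : R) : Prop :=
  0 < gamma /\
  exists rdelta rz : R,
    [/\ 0 < rdelta, 0 < rz,
        forall delta, eball 0 rdelta delta ->
          exists! z, (eball zs rz `&` linearized_solutions c g Omega zs delta) z
      & forall delta1 delta2 z1 z2,
          eball 0 rdelta delta1 -> eball 0 rdelta delta2 ->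
          (eball zs rz `&` linearized_solutions c g Omega zs delta1) z1 ->
          (eball zs rz `&` linearized_solutions c g Omega zs delta2) z2 ->
          enorm (z1 - z2) <= gamma * enorm (delta1 - delta2)].

Definition sub_objective (R : realType) (n m : nat) (c : 'cV[R]_n)
    (g : 'cV[R]_n -> 'cV[R]_m) (zj : 'cV[R]_(n + m)) (A : 'M[R]_(m, n))
    (H : 'M[R]_n) (x : 'cV[R]_n) : R :=
  let xj := usubmx zj in
  let mj := (jac g xj - A)^T *m dsubmx zj in
  vdot c x + vdot mj (x - xj) + 2^-1 * vdot (x - xj) (H *m (x - xj)).

Definition sub_linear_set (R : realType) (n m : nat)
    (g : 'cV[R]_n -> 'cV[R]_m) (zj : 'cV[R]_(n + m)) (A : 'M[R]_(m, n)) :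
    set 'cV[R]_n :=
  [set x | g (usubmx zj) + A *m (x - usubmx zj) = 0].

Definition sub_solutions (R : realType) (n m : nat) (c : 'cV[R]_n)
    (g : 'cV[R]_n -> 'cV[R]_m) (Omega : set 'cV[R]_n)
    (zj : 'cV[R]_(n + m)) (A : 'M[R]_(m, n)) (H : 'M[R]_n) :
    set 'cV[R]_n :=
  [set x | (sub_linear_set g zj A `&` Omega) x /\
     forall x', (sub_linear_set g zj A `&` Omega) x' ->
       sub_objective c g zj A H x <= sub_objective c g zj A H x'].

Definition slater (R : realType) (n m : nat)
    (g : 'cV[R]_n -> 'cV[R]_m) (Omega : set 'cV[R]_n)
    (zj : 'cV[R]_(n + m)) (A : 'M[R]_(m, n)) : Prop :=
  relint Omega `&` sub_linear_set g zj A !=set0.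

(* \tilde F'_j *)
Definition approx_jac (R : realType) (n m : nat) (A : 'M[R]_(m, n))
    (H : 'M[R]_n) : 'M[R]_(n + m) :=
  block_mx H A^T A 0.

Definition sub_KKT_points (R : realType) (n m : nat) (c : 'cV[R]_n)
    (g : 'cV[R]_n -> 'cV[R]_m) (Omega : set 'cV[R]_n)
    (zj : 'cV[R]_(n + m)) (A : 'M[R]_(m, n)) (H : 'M[R]_n) :
    set 'cV[R]_(n + m) :=
  [set z | [set KKT_map c g zj + approx_jac A H *m (z - zj) + u
             | u in normal_cone (Kset Omega) z] 0].

(* z is an infinite sequence generated by the full-step algorithm with the
   matrices A j, H j: z (j.+1) consists of a solution of P(z j, A j, H j) and a
   corresponding multiplier.  The Slater condition is the standing assumption
   on the subproblems. *)
Definition FASCP (R : realType) (n m : nat) (c : 'cV[R]_n)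
    (g : 'cV[R]_n -> 'cV[R]_m) (Omega : set 'cV[R]_n)
    (z : nat -> 'cV[R]_(n + m)) (A : nat -> 'M[R]_(m, n))
    (H : nat -> 'M[R]_n) : Prop :=
  [/\ Kset Omega (z 0%N),
      forall j, symmetric_psd (H j),
      forall j, slater g Omega (z j) (A j)
    & forall j,
        sub_solutions c g Omega (z j) (A j) (H j) (usubmx (z j.+1)) /\
        sub_KKT_points c g Omega (z j) (A j) (H j) (z j.+1)].

Definition converges_linearly (R : realType) (n : nat)
    (z : nat -> 'cV[R]_n) (l : 'cV[R]_n) : Prop :=
  z @ \oo --> l /\
  exists rho : R, [/\ 0 <= rho, rho < 1 &
    \forall j \near \oo, enorm (z j.+1 - l) <= rho * enorm (z j - l)].

(* Main.v *)
(* Write [M = F'(zs)], and let [B] be the matrix of the subproblem at [zj].  The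
   subproblem reads [delta(z) \in F(zs) + M (z - zs) + N_K(z)] with
   [delta(z) = (M - B) (z - zj) - (F(zj) - F(zs) - M (zj - zs))], so its KKT
   points near [zs] are the fixed points of [z |-> s(delta(z))], where [s] is the
   [gamma]-Lipschitz localization given by strong regularity.  This map is a
   contraction of ratio [gamma kappa < 1/2], and it preserves small balls since
   [F(zj) - F(zs) - M (zj - zs)] is at most [eps |zj - zs|]: this gives local
   existence and uniqueness.  As [H] is positive semidefinite, the KKT points of
   the subproblem form a convex set, so local uniqueness is global and the
   iterates cannot leave the ball.  The Lipschitz estimate also yields
   [(1 - gamma kappa) |z_{j+1} - zs| <= gamma (kappa + eps) |z_j - zs|], a linear
   rate below [1] once [gamma eps < 1 - 2 gamma kappa]; hence one may take
   [c1 = 0]. *)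
Require Import Defs.
From HB Require Import structures.
From mathcomp Require Import all_boot all_order all_algebra.
From mathcomp Require Import all_classical all_reals all_analysis.
From mathcomp Require Import ring lra.
Import Order.TTheory GRing.Theory Num.Theory.
Import numFieldNormedType.Exports.
Set Implicit Arguments.
Unset Strict Implicit.
Unset Printing Implicit Defensive.

Local Open Scope classical_set_scope.
Local Open Scope ring_scope.

(** * Euclidean inner product and norm, and comparison with the max-norm *)

Section Euclidean.
Context {R : realType}.
Implicit Types n m : nat.

Lemma vdotE n (u v : 'cV[R]_n) : vdot u v = \sum_i u i 0 * v i 0.
Proof. by rewrite /vdot mxE; apply: eq_bigr => i _; rewrite mxE. Qed.

Lemma vdotC n (u v : 'cV[R]_n) : vdot u v = vdot v u.
Proof. by rewrite !vdotE; apply: eq_bigr => i _; rewrite mulrC. Qed.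

Lemma vdotDl n (u v w : 'cV[R]_n) : vdot (u + v) w = vdot u w + vdot v w.
Proof. by rewrite /vdot linearD mulmxDl mxE. Qed.

Lemma vdotDr n (u v w : 'cV[R]_n) : vdot w (u + v) = vdot w u + vdot w v.
Proof. by rewrite vdotC vdotDl !(vdotC w). Qed.

Lemma vdotZl n a (u v : 'cV[R]_n) : vdot (a *: u) v = a * vdot u v.
Proof. by rewrite /vdot linearZ -scalemxAl mxE. Qed.

Lemma vdotZr n a (u v : 'cV[R]_n) : vdot u (a *: v) = a * vdot u v.
Proof. by rewrite vdotC vdotZl vdotC. Qed.

Lemma vdotNl n (u v : 'cV[R]_n) : vdot (- u) v = - vdot u v.
Proof. by rewrite -scaleN1r vdotZl mulN1r. Qed.

Lemma vdotNr n (u v : 'cV[R]_n) : vdot u (- v) = - vdot u v.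
Proof. by rewrite vdotC vdotNl vdotC. Qed.

Lemma vdot0l n (u : 'cV[R]_n) : vdot 0 u = 0.
Proof. by rewrite -(scale0r u) vdotZl mul0r. Qed.

Lemma vdot_ge0 n (u : 'cV[R]_n) : 0 <= vdot u u.
Proof. by rewrite vdotE sumr_ge0// => i _; rewrite -expr2 sqr_ge0. Qed.

Lemma vdot_eq0 n (u : 'cV[R]_n) : vdot u u = 0 -> u = 0.
Proof.
rewrite vdotE => /eqP; rewrite psumr_eq0; last first.
  by move=> i _; rewrite -expr2 sqr_ge0.
move=> /allP u0; apply/colP => i; rewrite mxE; apply/eqP.
by have := u0 i (mem_index_enum i); rewrite /= mulf_eq0 orbb.
Qed.

Lemma vdot_col_mx n m (u v : 'cV[R]_(n + m)) :
  vdot u v = vdot (usubmx u) (usubmx v) + vdot (dsubmx u) (dsubmx v).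
Proof.
by rewrite !vdotE big_split_ord/=; congr (_ + _);
   apply: eq_bigr => i _; rewrite !mxE.
Qed.

(** The squared norm of [vdot v v *: u - vdot u v *: v] is [vdot v v] times the difference of the
    two sides. *)
Lemma cauchy_schwarz n (u v : 'cV[R]_n) :
  vdot u v ^+ 2 <= vdot u u * vdot v v.
Proof.
have [v0|v0] := eqVneq (vdot v v) 0.
  by rewrite (vdot_eq0 v0) vdotC vdot0l expr0n vdot0l mulr0.
have vgt0 : 0 < vdot v v by rewrite lt_def v0 vdot_ge0.
have := vdot_ge0 (vdot v v *: u - vdot u v *: v).
rewrite !(vdotDl, vdotDr, vdotNl, vdotNr, vdotZl, vdotZr) (vdotC v u) => h.
rewrite -subr_ge0 -(pmulr_rge0 _ vgt0).
set a := vdot u v in h *; set b := vdot v v in h *; set d := vdot u u in h *.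
nra.
Qed.

Lemma enorm_ge0 n (x : 'cV[R]_n) : 0 <= enorm x.
Proof. exact: sqrtr_ge0. Qed.

Lemma sqr_enorm n (x : 'cV[R]_n) : enorm x ^+ 2 = vdot x x.
Proof. by rewrite sqr_sqrtr// vdot_ge0. Qed.

Lemma enorm0 n : enorm (0 : 'cV[R]_n) = 0.
Proof. by rewrite /enorm vdot0l sqrtr0. Qed.

Lemma enorm_eq0 n (x : 'cV[R]_n) : enorm x = 0 -> x = 0.
Proof. by move=> x0; apply: vdot_eq0; rewrite -sqr_enorm x0 expr0n. Qed.

Lemma enormZ n a (x : 'cV[R]_n) : enorm (a *: x) = `|a| * enorm x.
Proof.
by rewrite /enorm vdotZl vdotZr mulrA -expr2 sqrtrM ?sqr_ge0// sqrtr_sqr.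
Qed.

Lemma enormN n (x : 'cV[R]_n) : enorm (- x) = enorm x.
Proof. by rewrite -scaleN1r enormZ normrN1 mul1r. Qed.

Lemma enorm_distC n (x y : 'cV[R]_n) : enorm (x - y) = enorm (y - x).
Proof. by rewrite -opprB enormN. Qed.

Lemma vdot_le n (u v : 'cV[R]_n) : vdot u v <= enorm u * enorm v.
Proof.
apply: le_trans (ler_norm _) _.
rewrite -ler_sqr ?nnegrE ?mulr_ge0 ?enorm_ge0//.
by rewrite real_normK ?num_real// exprMn !sqr_enorm cauchy_schwarz.
Qed.

Lemma enormD n (x y : 'cV[R]_n) : enorm (x + y) <= enorm x + enorm y.
Proof.
rewrite -ler_sqr ?nnegrE ?addr_ge0 ?enorm_ge0// sqrrD !sqr_enorm.
rewrite vdotDl !vdotDr (vdotC y x).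
have := vdot_le x y; lra.
Qed.

Lemma enormB n (x y : 'cV[R]_n) : enorm (x - y) <= enorm x + enorm y.
Proof. by rewrite -(enormN y) enormD. Qed.

Lemma enorm_distD n (z x y : 'cV[R]_n) :
  enorm (x - y) <= enorm (x - z) + enorm (z - y).
Proof. by rewrite -[x - y](subrKA z) enormD. Qed.

Lemma coord_le_enorm n (x : 'cV[R]_n) i : `|x i 0| <= enorm x.
Proof.
rewrite -ler_sqr ?nnegrE ?enorm_ge0// sqr_enorm real_normK ?num_real//.
rewrite vdotE (bigD1 i)//= -expr2 lerDl sumr_ge0// => j _.
by rewrite -expr2 sqr_ge0.
Qed.

Lemma norm_le_enorm n (x : 'cV[R]_n) : `|x| <= enorm x.
Proof.
rewrite [leLHS]/Num.Def.normr /= mx_normrE; apply/bigmax_leP; split=> [|[i j] _].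
  exact: enorm_ge0.
by rewrite /= ord1 coord_le_enorm.
Qed.

(** The constant is crude, but it is positive even for [n = 0], so one can divide by it. *)
Lemma enorm_le_norm n (x : 'cV[R]_n) : enorm x <= n.+1%:R * `|x|.
Proof.
rewrite -ler_sqr ?nnegrE ?mulr_ge0 ?enorm_ge0// sqr_enorm vdotE exprMn.
have le_coord i : x i 0 * x i 0 <= `|x| ^+ 2.
  rewrite -expr2 -[leLHS]real_normK ?num_real// ler_sqr ?nnegrE//.
  rewrite [leRHS]/Num.Def.normr /= mx_normrE.
  exact: (le_bigmax _ (fun ij => `|x ij.1 ij.2|) (i, 0)).
apply: le_trans (ler_sum _ (fun i _ => le_coord i)) _.
rewrite sumr_const card_ord -[leLHS]mulr_natl ler_wpM2r ?sqr_ge0//.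
by rewrite -natrX ler_nat (leq_trans (leqnSn n))// expnS leq_pmulr// expn1.
Qed.

Lemma enorm_mulmx_le_opnorm m n (A : 'M[R]_(m, n)) (x : 'cV[R]_n) :
  enorm (A *m x) <= opnorm A * enorm x.
Proof.
have [x0|x0] := eqVneq (enorm x) 0.
  by rewrite (enorm_eq0 x0) mulmx0 !enorm0 mulr0.
have xgt0 : 0 < enorm x by rewrite lt_def x0 enorm_ge0.
have ubA : has_ubound
    [set enorm (A *m x) | x in [set x : 'cV[R]_n | enorm x <= 1]].
  (* The Frobenius norm is a bound, by Cauchy-Schwarz on each row; without a bound [sup] would carry
     no information. *)
  exists (Num.sqrt (\sum_i vdot (row i A)^T (row i A)^T)) => _ [u /= u1 <-].
  apply: ler_wsqrtr.
  rewrite vdotE; apply: ler_sum => i _.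
  have -> : (A *m u) i 0 = vdot (row i A)^T u.
    by rewrite vdotE mxE; apply: eq_bigr => j _; rewrite !mxE.
  rewrite -expr2; apply: le_trans (cauchy_schwarz _ _) _.
  rewrite ler_piMr ?vdot_ge0// -sqr_enorm expr_le1//; exact: enorm_ge0.
rewrite -ler_pdivrMr// mulrC.
rewrite -[X in X * _](@ger0_norm _ (enorm x)^-1) ?invr_ge0 ?enorm_ge0//.
rewrite -enormZ scalemxAr; apply: sup_upper_bound.
  by split=> //; exists (enorm (A *m 0)), 0 => //=; rewrite enorm0 ler01.
exists ((enorm x)^-1 *: x) => //=.
by rewrite enormZ ger0_norm ?invr_ge0 ?enorm_ge0// mulVf.
Qed.

Lemma enorm_dist_continuous n (a : 'cV[R]_n) :
  continuous (fun x : 'cV[R]_n => enorm (x - a)).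
Proof.
suff near_enorm (x : 'cV[R]_n) e : 0 < e ->
    \forall y \near x, `|enorm (x - a) - enorm (y - a)| < e.
  by move=> x; apply: (pseudometric_normed_Zmodule.cvgrPdist_lt
    (FF := nbhs_filter x) _ _).2 => e /(near_enorm x).
move=> e0; apply/nbhs_normP; exists (e / n.+1%:R); first by rewrite /= divr_gt0.
move=> y /=; rewrite ltr_pdivlMr// mulrC => xy.
apply: le_lt_trans (le_lt_trans (enorm_le_norm _) xy); rewrite ler_norml.
have := enorm_distD y x a; have := enorm_distD x y a.
rewrite (enorm_distC y x); lra.
Qed.

Lemma closed_enorm_ball n (a : 'cV[R]_n) r :
  closed [set x | enorm (x - a) <= r].
Proof.
apply: (@preimage_closed 'cV[R]_n R (fun x => enorm (x - a)) [set t | t <= r]).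
  by move=> x _; exact: enorm_dist_continuous.
exact: closed_le.
Qed.

End Euclidean.

(** * Fixed points of Euclidean contractions *)

HB.instance Definition _ (R : realType) m n := Complete.on 'M[R]_(m, n).

(* The library's fixed point theorem is about the max-norm, for which [f] need
   not be a contraction; by equivalence of norms a high iterate of [f] is. *)
Lemma enorm_contraction_fixpoint (R : realType) n
    (f : 'cV[R]_n -> 'cV[R]_n) (a : 'cV[R]_n) (r q : R) :
  0 <= r -> 0 <= q -> q < 1 ->
  (forall x, enorm (x - a) <= r -> enorm (f x - a) <= r) ->
  (forall x y, enorm (x - a) <= r -> enorm (y - a) <= r ->
     enorm (f x - f y) <= q * enorm (x - y)) ->
  exists2 p, enorm (p - a) <= r & f p = p.
Proof.
move=> r0 q0 q1 fU fq; pose U := [set x : 'cV[R]_n | enorm (x - a) <= r].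
have iterU k x : U x -> U (iter k f x) by move=> Ux; elim: k => //= k; apply: fU.
have iterq k x y : U x -> U y ->
    enorm (iter k f x - iter k f y) <= q ^+ k * enorm (x - y).
  move=> Ux Uy; elim: k => [|k IH]; first by rewrite expr0 mul1r.
  apply: le_trans (fq _ _ (iterU k x Ux) (iterU k y Uy)) _.
  by rewrite exprS -mulrA ler_wpM2l.
(* The power [q ^+ k] must beat the constant [n.+1] lost in passing between the two norms. *)
have [k kq] : exists k, q ^+ k * n.+1%:R < 1.
  have : (fun k => n.+1%:R * q ^+ k) @ \oo --> (0 : R).
    by apply: cvg_geometric; rewrite ger0_norm.
  move/pseudometric_normed_Zmodule.cvgrPdist_lt => /(_ _ ltr01)[k _ /(_ k (leqnn k))].
  rewrite sub0r normrN ger0_norm ?mulr_ge0 ?exprn_ge0// mulrC.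
  by exists k.
have funU : set_fun U U (iter k f) by move=> x; exact: iterU.
pose g : {fun U >-> U} := HB.pack (iter k f) (isFun.Build _ _ _ _ _ funU).
have ctr : is_contraction g.
  have c0 : 0 <= q ^+ k * n.+1%:R by rewrite mulr_ge0 ?exprn_ge0.
  exists (NngNum c0); split => //= -[x y] [/= Ux Uy].
  apply: le_trans (norm_le_enorm _) _; apply: le_trans (iterq k x y Ux Uy) _.
  by rewrite -mulrA ler_wpM2l ?exprn_ge0// enorm_le_norm.
have [p Up gp] : exists2 p, U p & p = g p.
  apply: (banach_fixed_point ctr); first exact: closed_enorm_ball.
  by exists a; rewrite /U/= subrr enorm0.
(* The iterate fixes [f p] as well as [p], and it contracts their distance by [q ^+ k < 1]; so they
   coincide. *)
exists p => //; apply/eqP; rewrite -subr_eq0; apply/eqP/enorm_eq0.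
have := iterq k (f p) p (fU _ Up) Up.
rewrite -iterSr iterS -[iter k f p]/(g p) -gp => le_fp.
apply/eqP; rewrite -[_ == 0]negbK; apply/negP => fp0.
have fp_gt0 : 0 < enorm (f p - p) by rewrite lt_def fp0 enorm_ge0.
move: le_fp; rewrite leNgt gtr_pMl// => /negP; apply.
by apply: le_lt_trans kq; rewrite ler_peMr ?exprn_ge0// ler1n.
Qed.

(** * Differentiability of the KKT map and its first-order expansion *)

Section Differentiability.
Context {R : realType}.

Lemma differentiable_col (V : normedModType R) n (f : V -> 'cV[R]_n) x :
  (forall i, differentiable (fun z => f z i 0 : R) x) -> differentiable f x.
Proof.
move=> df.
have -> : f = \sum_(i < n) (fun z => f z i 0 *: delta_mx i 0).
  apply/funext => z; rewrite fct_sumE {1}[f z]matrix_sum_delta.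
  by apply: eq_bigr => i _; rewrite big_ord1.
by apply: differentiable_sum => i; apply: differentiableZl.
Qed.

Lemma jac_mulmx n m (f : 'cV[R]_n -> 'cV[R]_m) x h : jac f x *m h = 'd f x h.
Proof.
rewrite {2}[h]matrix_sum_delta linear_sum/=; apply/colP => i.
rewrite mxE summxE; apply: eq_bigr => j _.
by rewrite big_ord1 linearZ/= !mxE mulrC.
Qed.

Lemma differentiable_jac_approx n m (f : 'cV[R]_n -> 'cV[R]_m) x e :
  differentiable f x -> 0 < e ->
  exists2 r, 0 < r & forall z, eball x r z ->
    enorm (f z - f x - jac f x *m (z - x)) <= e * enorm (z - x).
Proof.
move=> /diff_locallyP[_ /eqaddoP df] e0.
(* The little-o is in the max-norm; dividing by [m.+1] pays for the return to the Euclidean norm. *)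
have := df (e / m.+1%:R); rewrite divr_gt0// => /(_ isT).
move=> /nbhs_ballP[r /= r0 rP]; exists r => // z zr.
have zr' : ball (0 : 'cV[R]_n) r (z - x).
  rewrite -ball_normE/= sub0r normrN.
  exact: le_lt_trans (norm_le_enorm _) zr.
have := rP _ zr'; rewrite jac_mulmx /= !fctE /= subrK.
rewrite opprD addrA => fz; apply: le_trans (enorm_le_norm _) _.
rewrite mulrC -ler_pdivlMr// -mulrAC; apply: le_trans fz _.
by rewrite ler_wpM2l ?norm_le_enorm// divr_ge0// ltW.
Qed.

(** Coordinatewise, the upper block is a constant plus a sum of products of an entry of [jac g] with
    a multiplier, hence the second derivative of [g]. *)
Lemma differentiable_KKT_map n m (c : 'cV[R]_n) (g : 'cV[R]_n -> 'cV[R]_m) z :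
  twice_differentiable g -> differentiable (KKT_map c g) z.
Proof.
move=> [dg djg].
have du (w : 'cV[R]_(n + m)) : differentiable (@usubmx R n m 1) w.
  apply: differentiable_col => i.
  rewrite (_ : (fun _ => _) = (fun w : 'cV_(n + m) => w (lshift m i) 0)).
    exact: differentiable_coord.
  by apply/funext => u; rewrite mxE.
have dy i (w : 'cV[R]_(n + m)) : differentiable (fun u => dsubmx u i 0 : R) w.
  rewrite (_ : (fun _ => _) = (fun u : 'cV_(n + m) => u (rshift n i) 0)).
    exact: differentiable_coord.
  by apply/funext => u; rewrite mxE.
apply: differentiable_col => i.
case: (split_ordP i) => j ->{i}.
- have -> : (fun w => KKT_map c g w (lshift m j) 0) =
    cst (c j 0) + \sum_(l < m) (fun w : 'cV_(n + m) =>
       jac g (usubmx w) l j : R) * (fun w => dsubmx w l 0).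
    apply/funext => w; rewrite /KKT_map col_mxEu !mxE !fctE fct_sumE.
    by congr (_ + _); apply: eq_bigr => l _; rewrite mxE.
  apply: differentiableD; first exact: differentiable_cst.
  apply: differentiable_sum => l; apply: differentiableM; last exact: dy.
  apply: (@differentiable_comp _ _ _ _ (fun w => jac g (usubmx w))
    (fun M : 'M[R]_(m, n) => M l j)); last exact: differentiable_coord.
  exact: differentiable_comp.
- have -> : (fun w => KKT_map c g w (rshift n j) 0) =
    (fun w : 'cV_(n + m) => g (usubmx w) j 0).
    by apply/funext => w; rewrite /KKT_map col_mxEd.
  apply: (@differentiable_comp _ _ _ _ (fun w => g (usubmx w))
    (fun M : 'cV[R]_m => M j 0)); last exact: differentiable_coord.
  exact: differentiable_comp.
Qed.

End Differentiability.

(** * Inclusions whose perturbation depends on the solution *)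

(** If [s] selects the solution near [a], then [s \o f] has ratio [gamma * kappa], and
    [gamma * eta < r] makes it map the closed ball into the open one. *)
Lemma perturbed_localization_unique (R : realType) n
    (S : 'cV[R]_n -> set 'cV[R]_n) (f : 'cV[R]_n -> 'cV[R]_n) (a : 'cV[R]_n)
    (gamma rd rz r kappa eta : R) :
  0 <= gamma -> 0 < rd -> 0 < rz ->
  (forall d, eball 0 rd d -> exists! z, (eball a rz `&` S d) z) ->
  (forall d1 d2 z1 z2, eball 0 rd d1 -> eball 0 rd d2 ->
     (eball a rz `&` S d1) z1 -> (eball a rz `&` S d2) z2 ->
     enorm (z1 - z2) <= gamma * enorm (d1 - d2)) ->
  S 0 a ->
  0 < r -> r <= rz -> 0 <= kappa -> gamma * kappa < 1 ->
  eta < rd -> gamma * eta < r ->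
  (forall z, enorm (z - a) <= r -> enorm (f z) <= eta) ->
  (forall z1 z2, enorm (f z1 - f z2) <= kappa * enorm (z1 - z2)) ->
  exists! z, (eball a r `&` [set z | S (f z) z]) z.
Proof.
move=> gamma0 rd0 rz0 S_sol S_lip Sa r0 r_rz kappa0 gk eta_rd eta_r fle flip.
(* The value 0 outside the ball is a dummy: [fball] keeps the arguments of [s] inside. *)
have /choice[s sP] d : exists z, eball 0 rd d -> (eball a rz `&` S d) z.
  have [/S_sol[z [zS _]]|nd] := pselect (eball 0 rd d).
    by exists z.
  by exists 0.
have fball z : enorm (z - a) <= r -> eball 0 rd (f z).
  by move=> /fle fz; rewrite /eball/= subr0 (le_lt_trans fz).
have ball_a : eball a rz a by rewrite /eball/= subrr enorm0.
have ball_0 : eball (0 : 'cV[R]_n) rd 0 by rewrite /eball/= subrr enorm0.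
(* Compare with [a], the solution for the perturbation 0. *)
have near_a z : enorm (z - a) <= r -> enorm (s (f z) - a) < r.
  move=> za; apply: le_lt_trans eta_r.
  have := S_lip _ _ _ _ (fball _ za) ball_0 (sP _ (fball _ za)) (conj ball_a Sa).
  by rewrite subr0 => /le_trans -> //; rewrite ler_wpM2l// fle.
have [|||||p pa fp] := @enorm_contraction_fixpoint R n (s \o f) a r (gamma * kappa).
- exact: ltW.
- exact: (mulr_ge0 gamma0 kappa0).
- exact: gk.
- by move=> x /near_a /ltW.
- move=> x y xa ya /=.
  have := S_lip _ _ _ _ (fball _ xa) (fball _ ya) (sP _ (fball _ xa)) (sP _ (fball _ ya)).
  by move/le_trans; apply; rewrite -mulrA ler_wpM2l.
exists p; split.
  split; first by rewrite /eball/= -[in p - a]fp near_a.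
  by rewrite /= -[in X in S _ X]fp /=; have [] := sP _ (fball _ pa).
(* Any other solution satisfies the same Lipschitz estimate against [p], with ratio below 1. *)
move=> z [za Sz].
have za' : enorm (z - a) <= r by rewrite ltW.
have zrz : eball a rz z by rewrite /eball/= (lt_le_trans za).
have := S_lip _ _ _ _ (fball _ pa) (fball _ za') (sP _ (fball _ pa)) (conj zrz Sz).
rewrite -/((s \o f) p) fp => pz.
have {}pz : enorm (p - z) <= gamma * kappa * enorm (p - z).
  by apply: le_trans pz _; rewrite -mulrA ler_wpM2l.
apply/eqP; rewrite -subr_eq0; apply/eqP/enorm_eq0/eqP.
rewrite eq_le enorm_ge0 andbT leNgt; apply/negP => pz0.
by move: pz; rewrite leNgt gtr_pMl// gk.
Qed.

(* The [delta] for which the subproblem at [zj], with [B] in place of the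
   derivative of the KKT map, reads
   [delta \in F(zs) + F'(zs) (z - zs) + N_K(z)]. *)
Definition sub_residual (R : realType) n m (c : 'cV[R]_n)
    (g : 'cV[R]_n -> 'cV[R]_m) (zs zj : 'cV[R]_(n + m)) (B : 'M[R]_(n + m))
    (z : 'cV[R]_(n + m)) : 'cV[R]_(n + m) :=
  (jac (KKT_map c g) zs - B) *m (z - zj)
  - (KKT_map c g zj - KKT_map c g zs - jac (KKT_map c g) zs *m (zj - zs)).

(** * KKT points of the convex subproblem *)

Section SCP.
Context {R : realType} {n m : nat} {c : 'cV[R]_n} {g : 'cV[R]_n -> 'cV[R]_m}.
Context {Omega : set 'cV[R]_n}.
Local Notation F := (KKT_map c g).
Implicit Types (B : 'M[R]_(n + m)) (A : 'M[R]_(m, n)) (H : 'M[R]_n).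
Implicit Types (z zj zs : 'cV[R]_(n + m)).

Lemma linearized_residual zs zj B z :
  linearized_solutions c g Omega zs (sub_residual c g zs zj B z) z <->
  [set F zj + B *m (z - zj) + u | u in normal_cone (Kset Omega) z] 0.
Proof.
have split_res u : F zs + jac F zs *m (z - zs) + u - sub_residual c g zs zj B z =
    F zj + B *m (z - zj) + u.
  rewrite /sub_residual mulmxBl -[z - zs](subrKA zj) mulmxDr.
  rewrite !opprD !opprK; apply/colP => i; rewrite !mxE.
  set s1 := \sum_j _; set s2 := \sum_j _; set s3 := \sum_j _.
  ring.
split=> -[u zu eu]; exists u => //.
  by rewrite -split_res eu subrr.
by apply/eqP; rewrite -subr_eq0 split_res eu.
Qed.

Lemma sub_residual_le zs zj B z kappa :
  opnorm (jac F zs - B) <= kappa ->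
  enorm (sub_residual c g zs zj B z) <= kappa * enorm (z - zj) +
    enorm (F zj - F zs - jac F zs *m (zj - zs)).
Proof.
move=> Bk; apply: le_trans (enormB _ _) _; rewrite lerD2r.
by apply: le_trans (enorm_mulmx_le_opnorm _ _) _; rewrite ler_wpM2r ?enorm_ge0.
Qed.

(** The linearization error at [zj] cancels in the difference, leaving [jac F zs - B] applied to
    [z1 - z2]. *)
Lemma sub_residual_lipschitz zs zj B z1 z2 kappa :
  opnorm (jac F zs - B) <= kappa ->
  enorm (sub_residual c g zs zj B z1 - sub_residual c g zs zj B z2)
    <= kappa * enorm (z1 - z2).
Proof.
move=> Bk; rewrite /sub_residual.
move: (F zj - F zs - jac F zs *m (zj - zs)) => e; rewrite opprB subrKA -mulmxBr opprB subrKA.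
by apply: le_trans (enorm_mulmx_le_opnorm _ _) _; rewrite ler_wpM2r ?enorm_ge0.
Qed.

(** The multiplier is unconstrained, so [z] may be moved along the lower block of [u] itself. *)
Lemma normal_cone_Kset_dsubmx (z u : 'cV[R]_(n + m)) :
  normal_cone (Kset Omega) z u -> dsubmx u = 0.
Proof.
move=> [Oz zu]; apply: vdot_eq0; apply/eqP; rewrite eq_le vdot_ge0 andbT.
have := zu (z + col_mx 0 (dsubmx u)).
rewrite /Kset/= linearD/= col_mxKu addr0 => /(_ Oz).
rewrite opprD addrA subrr add0r vdotNr vdot_col_mx col_mxKu col_mxKd.
by rewrite vdotC vdot0l add0r oppr_ge0.
Qed.

(** A monotonicity argument. With [d = z2 - z1], the lower block of [B *m d] vanishes, so
    [vdot d (B *m d)] reduces to the quadratic form of [H]. Its sign and the two normality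
    inequalities force [u1] and [u2] to be orthogonal to [d]. *)
Lemma sub_KKT_points_convex zj A H z1 z2 (t : R) :
  convex_set Omega -> symmetric_psd H -> 0 <= t -> t <= 1 ->
  sub_KKT_points c g Omega zj A H z1 -> sub_KKT_points c g Omega zj A H z2 ->
  sub_KKT_points c g Omega zj A H (z1 + t *: (z2 - z1)).
Proof.
move=> Ocvx [_ Hpsd] t0 t1 [u1 zu1 eu1] [u2 zu2 eu2].
set d := z2 - z1; pose B := approx_jac A H.
have u12 : u1 - u2 = B *m d.
  have eu u z : F zj + B *m (z - zj) + u = 0 -> u = - (F zj + B *m (z - zj)).
    by move=> e; apply/eqP; rewrite -addr_eq0 addrC e.
  rewrite (eu _ _ eu1) (eu _ _ eu2) opprK addrC opprD addrACA subrr add0r.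
  by rewrite -mulmxBr opprB subrKA.
have d_B : vdot d (B *m d) >= 0.
  have Bd : B *m d = col_mx (H *m usubmx d + A^T *m dsubmx d) (A *m usubmx d).
    by rewrite -{1}(vsubmxK d) mul_block_col mul0mx addr0.
  have Ad : A *m usubmx d = 0.
    rewrite -[LHS](col_mxKd (H *m usubmx d + A^T *m dsubmx d)) -Bd -u12 linearB/=.
    by rewrite (normal_cone_Kset_dsubmx zu1) (normal_cone_Kset_dsubmx zu2) subrr.
  rewrite vdot_col_mx Bd col_mxKu col_mxKd Ad vdotDr.
  rewrite (_ : vdot (usubmx d) (A^T *m _) = vdot (A *m usubmx d) (dsubmx d)).
    by rewrite Ad vdot0l (vdotC _ 0) vdot0l !addr0 Hpsd.
  by rewrite /vdot trmx_mul mulmxA.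
have [[Oz1 n1] [Oz2 n2]] := (zu1, zu2).
have u1d : 0 <= vdot u1 (- d) by rewrite opprB n1.
have u2d : 0 <= vdot u2 d by rewrite n2.
have : vdot u1 d - vdot u2 d >= 0 by rewrite -vdotNl -vdotDl u12 vdotC.
rewrite vdotNr in u1d => u12d.
have {}u1d : vdot u1 d = 0 by lra.
have {}u2d : vdot u2 d = 0 by lra.
(* This is the combination of [u1] and [u2] with weights [1 - t] and [t]. *)
exists (u1 - t *: (B *m d)); last first.
  rewrite -[RHS]eu1 -[z1 + _ - zj]addrAC mulmxDr -scalemxAr.
  by apply/colP => i; rewrite !mxE; ring.
split.
  rewrite /Kset/= linearD/= linearZ/= linearB/=.
  have := Ocvx (usubmx z2) (usubmx z1) (Itv01 t0 t1).
  rewrite !inE => /(_ Oz2 Oz1); rewrite /conv/=.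
  rewrite scalerBl scale1r scalerBr => h.
  by rewrite addrCA.
move=> v Ov; rewrite -u12.
(* Orthogonality to [d] lets both normality inequalities be read at [z1], where they can be
   averaged. *)
have u2v : vdot u2 (z2 - v) = vdot u2 (z1 - v).
  by rewrite -[z2 - v](subrKA z1) -/d (vdotDr d) u2d add0r.
move: (n1 v Ov) (n2 v Ov); rewrite u2v addrAC; move: (z1 - v) => w.
rewrite vdotDr vdotZr !(vdotDl, vdotZl, vdotNl) u1d u2d; nra.
Qed.

(** The segment from [z1] to [z2] consists of KKT points and starts inside the open ball, so a
    second KKT point anywhere would give a second one in the ball. *)
Lemma sub_KKT_points_local_unique zj A H a r z1 z2 :
  convex_set Omega -> symmetric_psd H ->
  (exists! z, (eball a r `&` sub_KKT_points c g Omega zj A H) z) ->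
  eball a r z1 ->
  sub_KKT_points c g Omega zj A H z1 -> sub_KKT_points c g Omega zj A H z2 ->
  z2 = z1.
Proof.
move=> Ocvx Hpsd [z0 [_ z0u]] z1r k1 k2.
have s0 : 0 < r - enorm (z1 - a) by rewrite subr_gt0.
set s := r - enorm (z1 - a) in s0.
have sd0 : 0 < s + enorm (z2 - z1) by rewrite ltr_pwDl ?enorm_ge0.
(* A step of length below the slack [s]; the extra [s] in the denominator keeps it positive and [t]
   at most 1. *)
pose t := s / (s + enorm (z2 - z1)).
have t0 : 0 < t by rewrite divr_gt0.
have t1 : t <= 1 by rewrite ler_pdivrMr// mul1r lerDl enorm_ge0.
have ts : t * enorm (z2 - z1) < s.
  by rewrite mulrAC ltr_pdivrMr// ltr_pM2l// ltrDr.
have kt := sub_KKT_points_convex Ocvx Hpsd (ltW t0) t1 k1 k2.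
have tr : eball a r (z1 + t *: (z2 - z1)).
  rewrite /eball/= addrAC; apply: le_lt_trans (enormD _ _) _.
  rewrite enormZ gtr0_norm//; move: ts; rewrite /s; lra.
have e1 := z0u _ (conj z1r k1); have := z0u _ (conj tr kt); rewrite e1.
move/eqP; rewrite -subr_eq0 opprD addrA subrr add0r oppr_eq0.
by rewrite scaler_eq0 gt_eqF//= subr_eq0 => /eqP.
Qed.

End SCP.

(** * From a contraction estimate to linear convergence *)

Lemma contracting_converges_linearly (R : realType) n (z : nat -> 'cV[R]_n)
    (l : 'cV[R]_n) (rho : R) :
  0 <= rho -> rho < 1 ->
  (forall j, enorm (z j.+1 - l) <= rho * enorm (z j - l)) ->
  converges_linearly z l.
Proof.
move=> rho0 rho1 zl; split; last by exists rho; split=> //; exact: nearW.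
have zj j : enorm (z j - l) <= geometric (enorm (z 0%N - l)) rho j.
  elim: j => [|j IH]; first by rewrite /= expr0 mulr1.
  by apply: le_trans (zl j) _; rewrite /= exprS mulrCA ler_wpM2l.
apply/pseudometric_normed_Zmodule.cvgrPdist_lt => e e0.
have : geometric (enorm (z 0%N - l)) rho @ \oo --> (0 : R).
  by apply: cvg_geometric; rewrite ger0_norm.
move/pseudometric_normed_Zmodule.cvgrPdist_lt => /(_ _ e0).
apply: filterS => j; rewrite sub0r normrN => /(le_lt_trans (ler_norm _)).
apply: le_lt_trans; apply: le_trans (zj j).
by rewrite enorm_distC norm_le_enorm.
Qed.

Theorem corollary4p1 (R : realType) (n m : nat) (c : 'cV[R]_n)
  (g : 'cV[R]_n -> 'cV[R]_m) (Omega : set 'cV[R]_n)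
  (Omega_nonempty : Omega !=set0) (Omega_closed : closed Omega)
  (Omega_convex : convex_set Omega)
  (Zs_nonempty : KKT_points c g Omega !=set0)
  (zs : 'cV[R]_(n + m)) (zs_KKT : KKT_points c g Omega zs)
  (g_diff2 : twice_differentiable g)
  (gamma : R) (zs_regular : strongly_regular c g Omega zs gamma)
  (kappa : R) (kappa_ge0 : 0 <= kappa) (kappa_lt : kappa < (2 * gamma)^-1)
  (rhat : R) (rhat_gt0 : 0 < rhat) :
  exists rz : R, [/\ 0 < rz,
    (forall (zj : 'cV[R]_(n + m)) (A : 'M[R]_(m, n)) (H : 'M[R]_n),
       Kset Omega zj -> symmetric_psd H -> slater g Omega zj A ->
       (eball zs rhat zj ->
          opnorm (jac (KKT_map c g) zs - approx_jac A H) <= kappa) ->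
       eball zs rz zj ->
       exists! z, (eball zs rz `&` sub_KKT_points c g Omega zj A H) z)
  & forall omega : R, 0 <= omega ->
      (forall z, eball zs rz z ->
         opnorm (jac (KKT_map c g) z - jac (KKT_map c g) zs)
           <= omega * enorm (z - zs)) ->
      (exists alpha c1 : R, [/\ 0 <= alpha, alpha < 1, 0 <= c1
       & forall (z : nat -> 'cV[R]_(n + m)) (A : nat -> 'M[R]_(m, n))
                (H : nat -> 'M[R]_n),
           FASCP c g Omega z A H ->
           (forall j, eball zs rhat (z j) ->
              opnorm (jac (KKT_map c g) zs - approx_jac (A j) (H j))
                <= kappa) ->
           eball zs rz (z 0%N) ->
           (forall j, enorm (z j.+1 - zs)
              <= (alpha + c1 * enorm (z j - zs)) * enorm (z j - zs)) /\
           converges_linearly z zs])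
      /\ eball zs rz `&` KKT_points c g Omega = [set zs]].
Proof.
have [gamma0 [rd [rl [rd0 rl0 Ssol Slip]]]] := zs_regular.
have gk : 2 * (gamma * kappa) < 1.
  have g2 : 0 < 2 * gamma by rewrite mulr_gt0.
  by move: kappa_lt; rewrite -[_^-1]mul1r ltr_pdivlMr// mulrC mulrA.
(* [gamma * eps] is half the gap [1 - 2 * (gamma * kappa)], so that [gamma * (kappa + eps)] is
   exactly [1 / 2]. *)
have [eps eps0 geps] : exists2 eps, 0 < eps &
    gamma * eps = (1 - 2 * (gamma * kappa)) / 2.
  exists ((1 - 2 * (gamma * kappa)) / (2 * gamma)).
    by rewrite divr_gt0 ?subr_gt0 ?mulr_gt0.
  by field; rewrite gt_eqF.
have gk0 : 0 <= gamma * kappa by rewrite mulr_ge0// ltW.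
have [ra ra0 Fzs] := differentiable_jac_approx
  (differentiable_KKT_map c zs g_diff2) eps0.
(* The four bounds serve the localization, the hypothesis on the matrices, the linearization error,
   and [small_rd]: through the last, [gamma * t < r] also puts [t] below [rd]. *)
pose r := Num.min (Num.min rl rhat) (Num.min ra (gamma * rd)).
have r0 : 0 < r by rewrite !lt_min rl0 rhat_gt0 ra0 mulr_gt0.
have [r_rl r_rhat r_ra r_rd] : [/\ r <= rl, r <= rhat, r <= ra & r <= gamma * rd].
  by split; rewrite !ge_min lexx ?orbT.
have rem_le zj : eball zs r zj -> enorm (KKT_map c g zj - KKT_map c g zs -
    jac (KKT_map c g) zs *m (zj - zs)) <= eps * enorm (zj - zs).
  by move=> zr; apply: Fzs; rewrite /eball/= (lt_le_trans zr).
have zs_ball e : 0 < e -> eball zs e zs by rewrite /eball/= subrr enorm0.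
have zs_sol : linearized_solutions c g Omega zs 0 zs.
  have [u zu eu] := zs_KKT; exists u => //.
  by rewrite subrr mulmx0 addr0.
have sol_le d z : eball zs r z -> enorm d < rd ->
    linearized_solutions c g Omega zs d z -> enorm (z - zs) <= gamma * enorm d.
  move=> zr dd Lz; rewrite -[d in leRHS]subr0.
  apply: Slip.
  - by rewrite /eball/= subr0.
  - by rewrite /eball/= subr0 enorm0.
  - by split=> //; rewrite /eball/= (lt_le_trans zr).
  - by split=> //; exact: zs_ball.
have small_rd t : gamma * t < r -> t < rd.
  by move=> /lt_le_trans /(_ r_rd); rewrite ltr_pM2l.
have sub_exists zj A H : eball zs r zj ->
    opnorm (jac (KKT_map c g) zs - approx_jac A H) <= kappa ->
    exists! z, (eball zs r `&` sub_KKT_points c g Omega zj A H) z.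
  move=> zjr AH.
  (* Two points of the ball are at most [2 * r] apart, so the residual is at most
     [(2 * kappa + eps) * r]; its factor times [gamma] is [1 / 2 + gamma * kappa < 1]. *)
  have eta_r : gamma * ((2 * kappa + eps) * r) < r.
    rewrite mulrA gtr_pMl// mulrDr geps; lra.
  have -> : sub_KKT_points c g Omega zj A H = [set z | linearized_solutions
      c g Omega zs (sub_residual c g zs zj (approx_jac A H) z) z].
    apply/seteqP; split=> z.
      exact: (linearized_residual zs zj (approx_jac A H) z).2.
    exact: (linearized_residual zs zj (approx_jac A H) z).1.
  apply: (perturbed_localization_unique (ltW gamma0) rd0 rl0 Ssol Slip zs_sol
    r0 r_rl kappa_ge0 _ (small_rd _ eta_r) eta_r).
  - lra.
  - move=> z zr; apply: le_trans (sub_residual_le _ _ AH) _.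
    have zzj : enorm (z - zj) <= 2 * r.
      apply: le_trans (enorm_distD zs _ _) _; rewrite (enorm_distC zs).
      by move: zjr; rewrite /eball/=; lra.
    apply: le_trans (lerD (ler_wpM2l kappa_ge0 zzj) (rem_le _ zjr)) _.
    have := ler_wpM2l (ltW eps0) (ltW zjr); lra.
  - by move=> z1 z2; exact: sub_residual_lipschitz.
(* The numerator is [1 / 2] and the denominator exceeds [1 / 2]. *)
pose alpha := gamma * (kappa + eps) / (1 - gamma * kappa).
have gk1 : 0 < 1 - gamma * kappa by lra.
have alpha0 : 0 <= alpha.
  by apply: divr_ge0 (ltW gk1); rewrite mulr_ge0 ?addr_ge0 ?(ltW gamma0)// ltW.
have alpha1 : alpha < 1 by rewrite ltr_pdivrMr// mulrDr geps; lra.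
have step zj A H z : eball zs r zj ->
    opnorm (jac (KKT_map c g) zs - approx_jac A H) <= kappa ->
    eball zs r z -> sub_KKT_points c g Omega zj A H z ->
    enorm (z - zs) <= alpha * enorm (zj - zs).
  move=> zjr AH zr zK.
  have Lz := (linearized_residual zs zj (approx_jac A H) z).2 zK.
  have le_res := le_trans (sub_residual_le zj z AH) (lerD (lexx _) (rem_le _ zjr)).
  (* Passing through [zs] produces a term [gamma * kappa * enorm (z - zs)], absorbed on the left at
     the end; this is the denominator of [alpha]. *)
  have zzj := enorm_distD zs z zj; rewrite (enorm_distC zs) in zzj.
  have {}le_res := le_trans le_res (lerD (ler_wpM2l kappa_ge0 zzj) (lexx _)).
  have {le_res}gle_res := ler_wpM2l (ltW gamma0) le_res.
  rewrite mulrDr !mulrA geps [_ * (_ + _)]mulrDr in gle_res.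
  have dz := enorm_ge0 (z - zs).
  have res_rd : enorm (sub_residual c g zs zj (approx_jac A H) z) < rd.
    apply: small_rd; apply: le_lt_trans gle_res _.
    have := ler_wpM2l gk0 (ltW zr).
    have := ler_wpM2l gk0 (ltW zjr).
    have : (1 - 2 * (gamma * kappa)) / 2 * enorm (zj - zs) <=
           (1 - 2 * (gamma * kappa)) / 2 * r.
      by rewrite ler_wpM2l ?ltW//; lra.
    have : 0 < (1 - 2 * (gamma * kappa)) / 2 * r by rewrite mulr_gt0//; lra.
    lra.
  have := le_trans (sol_le _ _ zr res_rd Lz) gle_res => z_le.
  by rewrite /alpha mulrAC ler_pdivlMr// (mulrDr gamma) geps; lra.
exists r; split=> //.
  move=> zj A H _ _ _ AH zjr; apply: sub_exists => //; apply: AH.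
  by rewrite /eball/= (lt_le_trans zjr).
move=> omega _ _; split.
  exists alpha, 0; split=> // z A H [_ Hpsd _ zKKT] AH z0r.
  have next j : eball zs r (z j) ->
      eball zs r (z j.+1) /\ enorm (z j.+1 - zs) <= alpha * enorm (z j - zs).
    move=> zjr.
    have {}AH : opnorm (jac (KKT_map c g) zs - approx_jac (A j) (H j)) <= kappa.
      by apply: AH; rewrite /eball/= (lt_le_trans zjr).
    have ex := sub_exists _ _ _ zjr AH; have [w [[wr wK] _]] := ex.
    (* The algorithm only says that [z j.+1] is a KKT point somewhere; global uniqueness places it
       in the ball. *)
    have -> : z j.+1 = w.
      exact: (sub_KKT_points_local_unique Omega_convex (Hpsd j) ex wr wK (zKKT j).2).
    by split=> //; apply: step wK.
  have zr j : eball zs r (z j) by elim: j => // j /next[].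
  have le_alpha j := (next j (zr j)).2.
  split; last exact: contracting_converges_linearly le_alpha.
  by move=> j; rewrite mul0r addr0.
apply/seteqP; split=> [z [zr zK]|_ ->]; last by split=> //; exact: zs_ball.
(* A KKT point [z] of the original problem solves the subproblem based at [z] itself with the exact
   matrix at [zs]. The residual is then minus the linearization error, and [gamma * eps < 1] forces
   [z = zs]. *)
have Lz : linearized_solutions c g Omega zs
    (sub_residual c g zs z (jac (KKT_map c g) zs) z) z.
  apply/linearized_residual; have [u zu eu] := zK; exists u => //.
  by rewrite subrr mulmx0 addr0.
move: Lz; rewrite /sub_residual subrr mul0mx sub0r => Lz.
have g_rem := ler_wpM2l (ltW gamma0) (rem_le _ zr).
rewrite mulrA geps -enormN in g_rem.
have dz := enorm_ge0 (z - zs).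
have := sol_le _ _ zr _ Lz.
have small : enorm (- (KKT_map c g z - KKT_map c g zs -
    jac (KKT_map c g) zs *m (z - zs))) < rd.
  apply: small_rd; apply: le_lt_trans g_rem _; apply: le_lt_trans zr.
  by rewrite ler_piMl//; lra.
move=> /(_ small) /le_trans /(_ g_rem) z_le.
apply/eqP; rewrite -subr_eq0; apply/eqP/enorm_eq0/eqP.
rewrite eq_le dz andbT; have := mulr_ge0 gk0 dz; lra.
Qed.
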